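(* Let $X$ be a path connected topological space with base point $x_0$, let $H$ be a normal subgroup of $\pi_1(X,x_0)$, and suppose that $X$ is $H$-SLT at $x_0$. Then $(p_H^{-1}(x_0))^{wh}$, with the group operation $[\alpha]_H\cdot[\beta]_H=[\alpha\ast\beta]_H$, is a topological group.
   Context: Let $\ast$ denote concatenation of paths and $\alpha^{-1}$ the reverse path. Let $P(X,x_0)$ be the set of paths in $X$ starting at $x_0$. For $H\le\pi_1(X,x_0)$ put $\alpha\sim_H\beta$ iff $\alpha(1)=\beta(1)$ and $[\alpha\ast\beta^{-1}]\in H$; the class of $\alpha$ is $[\alpha]_H$ and $\tilde X_H$ is the set of all classes. The whisker topology on $\tilde X_H$ has as basis the sets $([\alpha]_H,U)=\{[\alpha\ast\beta]_H : \beta \text{ a path in } U \text{ with } \beta(0)=\alpha(1)\}$, where $\alpha\in P(X,x_0)$ and $U$ is an open neighborhood of $\alpha(1)$; the resulting space is $\tilde X_H^{wh}$. The endpoint projection is $p_H:\tilde X_H\to X$, $p_H([\alpha]_H)=\alpha(1)$. $(p_H^{-1}(x_0))^{wh}$ is the fiber $p_H^{-1}(x_0)$ with the subspace topology from $\tilde X_H^{wh}$. When $H$ is normal, $p_H^{-1}(x_0)$ is a group under $[\alpha]_H\cdot[\beta]_H=[\alpha\ast\beta]_H$. $X$ is $H$-SLT at $x_0$ if for every path $\alpha$ in $X$ beginning at $x_0$ and every open set $U\ni x_0$ there is an open set $V\ni\alpha(1)$ such that for every loop $\beta$ in $V$ based at $\alpha(1)$ there is a loop $\gamma$ in $U$ based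 at $x_0$ with $[\alpha\ast\beta\ast\alpha^{-1}]_H=[\gamma]_H$. *)

(* Defs.v *)
From HB Require Import structures.
From mathcomp Require Import all_boot all_order all_algebra generic_quotient.
From mathcomp Require Import all_classical all_reals.
From mathcomp Require Import topology normedtype homotopy ring lra.

Set Implicit Arguments.
Unset Strict Implicit.
Unset Printing Implicit Defensive.

Import Order.TTheory GRing.Theory Num.Theory numFieldNormedType.Exports.
Local Open Scope classical_set_scope.
Local Open Scope ring_scope.
Local Open Scope quotient_scope.

Definition unit_itv (R : realType) : Type := set_type (`[0, 1]%classic : set R).

Section UnitInterval.
Context {R : realType}.
Local Notation I := (unit_itv R).

HB.instance Definition _ :=
  Topological.copy I (set_type (`[0, 1]%classic : set R)).

Lemma itv_clamp_subproof (r : R) :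
  Num.max 0 (Num.min 1 r) \in (`[0, 1]%classic : set R).
Proof.
apply/mem_set; rewrite /= in_itv /= le_max lexx /= ge_max ler01 /=.
by rewrite ge_min lexx.
Qed.

(* The retraction of the line onto the unit interval: it lets the usual
   formulas t |-> 2t, 2t - 1, 1 - t be used as parameters of paths. *)
Definition itv_clamp (r : R) : I :=
  exist (fun t => t \in (`[0, 1]%classic : set R)) _ (itv_clamp_subproof r).

Definition itv_val (t : I) : R := set_val t.

Lemma itv_val_ge0 (t : I) : 0 <= itv_val t.
Proof. by case: t => r rI; rewrite /itv_val set_valE /=; move: rI => /set_mem; rewrite /= in_itv /= => /andP[]. Qed.

Lemma itv_val_le1 (t : I) : itv_val t <= 1.
Proof. by case: t => r rI; rewrite /itv_val set_valE /=; move: rI => /set_mem; rewrite /= in_itv /= => /andP[]. Qed.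

Lemma itv_val_inj : injective itv_val.
Proof. by move=> s t /val_inj. Qed.

Lemma itv_clampE (r : R) : itv_val (itv_clamp r) = Num.max 0 (Num.min 1 r).
Proof. by []. Qed.

Lemma itv_clampK r : 0 <= r -> r <= 1 -> itv_val (itv_clamp r) = r.
Proof. by move=> r0 r1; rewrite itv_clampE min_r // max_r. Qed.

Lemma itv_clamp_val t : itv_clamp (itv_val t) = t.
Proof.
by apply: itv_val_inj; rewrite itv_clampK ?itv_val_ge0 ?itv_val_le1.
Qed.

Lemma itv_clamp_neq : itv_clamp 0 != itv_clamp 1.
Proof.
apply/eqP => /(congr1 itv_val); rewrite !itv_clampK ?ler01 ?lexx //.
by move/esym/eqP; rewrite oner_eq0.
Qed.

HB.instance Definition _ := isBiPointed.Build I itv_clamp_neq.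

Lemma itv_val_zero : itv_val zero = 0.
Proof. by rewrite itv_clampK. Qed.

Lemma itv_val_one : itv_val one = 1.
Proof. by rewrite itv_clampK. Qed.

Lemma itv_val_continuous : continuous itv_val.
Proof. exact: initial_continuous. Qed.

Lemma itv_clamp_continuous : continuous itv_clamp.
Proof.
apply/continuousP => _ [B oB <-].
rewrite (_ : itv_clamp @^-1` _ = (fun r => Num.max 0 (Num.min 1 r)) @^-1` B) //.
have /continuousP : continuous (fun r : R => Num.max 0 (Num.min 1 r)).
  move=> r; apply: (@continuous_max R R (cst 0) (fun r => Num.min 1 r) r).
    exact: cvg_cst.
  by apply: (@continuous_min R R (cst 1) id r); [exact: cvg_cst|exact: cvg_id].
exact.
Qed.

End UnitInterval.

Section ContinuousHelpers.
Context {R : realType} {Z : topologicalType}.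
Implicit Types f g : Z -> R.

Lemma cont_cst (U : topologicalType) (a : U) : continuous (fun _ : Z => a).
Proof. by move=> t; exact: cvg_cst. Qed.

Lemma cont_comp (U V : topologicalType) (g : U -> V) (f : Z -> U) :
  continuous g -> continuous f -> continuous (fun t => g (f t)).
Proof. by move=> cg cf t; apply: continuous_comp; [exact: cf|exact: cg]. Qed.

Lemma cont_pair (U V : topologicalType) (f : Z -> U) (g : Z -> V) :
  continuous f -> continuous g -> continuous (fun t => (f t, g t)).
Proof. by move=> cf cg t; apply: cvg_pair; [exact: cf|exact: cg]. Qed.

Lemma contD f g : continuous f -> continuous g -> continuous (fun t => f t + g t).
Proof. by move=> cf cg t; apply: cvgD; [exact: cf|exact: cg]. Qed.

Lemma contB f g : continuous f -> continuous g -> continuous (fun t => f t - g t).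
Proof. by move=> cf cg t; apply: cvgB; [exact: cf|exact: cg]. Qed.

Lemma contM f g : continuous f -> continuous g -> continuous (fun t => f t * g t).
Proof. by move=> cf cg t; apply: cvgM; [exact: cf|exact: cg]. Qed.

Lemma cont_max f g :
  continuous f -> continuous g -> continuous (fun t => Num.max (f t) (g t)).
Proof.
by move=> cf cg t; apply: (@continuous_max R Z f g t); [exact: cf|exact: cg].
Qed.

Lemma cont_min f g :
  continuous f -> continuous g -> continuous (fun t => Num.min (f t) (g t)).
Proof.
by move=> cf cg t; apply: (@continuous_min R Z f g t); [exact: cf|exact: cg].
Qed.

End ContinuousHelpers.

Lemma itv_val_fst_continuous (R : realType) :
  continuous (fun u : unit_itv R * unit_itv R => itv_val u.1).
Proof. by apply: (cont_comp itv_val_continuous) => u; exact: cvg_fst. Qed.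

Lemma itv_val_snd_continuous (R : realType) :
  continuous (fun u : unit_itv R * unit_itv R => itv_val u.2).
Proof. by apply: (cont_comp itv_val_continuous) => u; exact: cvg_snd. Qed.

Ltac itv_continuity := repeat first
  [ assumption | exact: cont_cst | exact: itv_val_continuous
  | exact: itv_val_fst_continuous | exact: itv_val_snd_continuous
  | apply: contB | apply: contD | apply: contM
  | apply: cont_max | apply: cont_min ].

Section Paths.
Context {R : realType} {X : topologicalType}.
Local Notation I := (unit_itv R).
Implicit Types x y z w : X.

Lemma continuous_if_le (Z : topologicalType) (f g : Z -> X) (c : Z -> R)
    (a : R) :
  continuous f -> continuous g -> continuous c ->
  (forall t, c t = a -> f t = g t) ->
  continuous (fun t => if c t <= a then f t else g t).
Proof.
move=> cf cg cc fg t A /=; case: (ltgtP (c t) a) => [lta|gta|eqa] At.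
- have : nbhs t (c @^-1` [set r | r < a]) := cc t _ (lt_nbhsl lta).
  have : nbhs t (f @^-1` A) by exact: cf.
  by apply: filterS2 => u /= Au /ltW ->.
- have : nbhs t (c @^-1` [set r | a < r]) := cc t _ (lt_nbhsr gta).
  have : nbhs t (g @^-1` A) by exact: cg.
  by apply: filterS2 => u /= Au; rewrite ltNge => /negbTE ->.
- have : nbhs t (f @^-1` A) by exact: cf.
  have : nbhs t (g @^-1` A) by apply: cg; rewrite -fg.
  by apply: filterS2 => u /= gA fA; case: ifP.
Qed.

Lemma comp_itv_clamp_continuous (Z : topologicalType) (f : I -> X)
    (c : Z -> R) :
  continuous f -> continuous c -> continuous (fun t => f (itv_clamp (c t))).
Proof.
by move=> cf cc; exact: (cont_comp cf (cont_comp itv_clamp_continuous cc)).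
Qed.

Lemma itv_clamp_le0 (r : R) : r <= 0 -> itv_clamp r = zero.
Proof.
move=> r0; apply: itv_val_inj; rewrite itv_val_zero itv_clampE max_l //.
by rewrite ge_min r0 orbT.
Qed.

Lemma itv_clamp_ge1 (r : R) : 1 <= r -> itv_clamp r = one.
Proof.
move=> r1; apply: itv_val_inj; rewrite itv_val_one itv_clampE min_l //.
by rewrite max_r.
Qed.

Lemma itv_affine_continuous (a b : R) :
  continuous (fun t : I => a * itv_val t + b).
Proof. by itv_continuity. Qed.

Definition path_inv_fun (p : I -> X) (t : I) : X := p (itv_clamp (1 - itv_val t)).

Definition path_cat_fun (p q : I -> X) (t : I) : X :=
  if itv_val t <= 2^-1 then p (itv_clamp (2 * itv_val t))
  else q (itv_clamp (2 * itv_val t - 1)).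

Section inv.
Context {x y} (p : {path I from x to y}).

Let path_inv_continuous : continuous (path_inv_fun p).
Proof.
apply: comp_itv_clamp_continuous; first exact: cts_fun.
by itv_continuity.
Qed.

Let path_inv_zero : path_inv_fun p zero = y.
Proof.
by rewrite /path_inv_fun itv_val_zero subr0 itv_clamp_ge1 // path_one.
Qed.

Let path_inv_one : path_inv_fun p one = x.
Proof.
by rewrite /path_inv_fun itv_val_one subrr itv_clamp_le0 // path_zero.
Qed.

Definition path_inv : {path I from y to x} :=
  mk_path path_inv_continuous path_inv_zero path_inv_one.

End inv.

Section cat.
Context {x y z} (p : {path I from x to y}) (q : {path I from y to z}).

Let path_cat_continuous : continuous (path_cat_fun p q).
Proof.
apply: continuous_if_le.
- apply: comp_itv_clamp_continuous; first exact: cts_fun.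
  by itv_continuity.
- apply: comp_itv_clamp_continuous; first exact: cts_fun.
  exact: itv_affine_continuous.
- exact: itv_val_continuous.
move=> t ->; rewrite mulfV ?pnatr_eq0 // subrr itv_clamp_ge1 //.
by rewrite itv_clamp_le0 // path_zero path_one.
Qed.

Let path_cat_zero : path_cat_fun p q zero = x.
Proof.
rewrite /path_cat_fun itv_val_zero invr_ge0 ler0n mulr0 itv_clamp_le0 //.
by rewrite path_zero.
Qed.

Let path_cat_one : path_cat_fun p q one = z.
Proof.
rewrite /path_cat_fun itv_val_one ifF; last by apply/negbTE; lra.
by rewrite itv_clamp_ge1 ?path_one //; lra.
Qed.

Definition path_cat : {path I from x to z} :=
  mk_path path_cat_continuous path_cat_zero path_cat_one.

End cat.

Definition cst_path x : {path I from x to x} := cst x.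

Definition path_homotopic {x y} (p q : {path I from x to y}) : Prop :=
  exists h : I * I -> X,
    [/\ continuous h, (forall t, h (t, zero) = p t),
        (forall t, h (t, one) = q t), (forall s, h (zero, s) = x)
      & (forall s, h (one, s) = y)].

Lemma comp_itv_clamp2_continuous (h : I * I -> X) (c d : I * I -> R) :
  continuous h -> continuous c -> continuous d ->
  continuous (fun u => h (itv_clamp (c u), itv_clamp (d u))).
Proof.
move=> ch cc cd; apply: (cont_comp ch).
by apply: cont_pair; apply: (cont_comp itv_clamp_continuous).
Qed.

Lemma reparam_homotopic x y x' y' (w : {path I from x to y}) (c d : I -> R)
    (p q : {path I from x' to y'}) :
  continuous c -> continuous d -> c zero = d zero -> c one = d one ->
  p =1 (fun t => w (itv_clamp (c t))) -> q =1 (fun t => w (itv_clamp (d t))) ->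
  path_homotopic p q.
Proof.
move=> cc cd cd0 cd1 pE qE.
exists (fun u => w (itv_clamp ((1 - itv_val u.2) * c u.1 + itv_val u.2 * d u.1))).
split.
- apply: comp_itv_clamp_continuous; first exact: cts_fun.
  apply: contD; apply: contM.
  + by itv_continuity.
  + by apply: (cont_comp cc) => u; exact: cvg_fst.
  + exact: itv_val_snd_continuous.
  + by apply: (cont_comp cd) => u; exact: cvg_fst.
- by move=> t /=; rewrite pE itv_val_zero subr0 mul1r mul0r addr0.
- by move=> t /=; rewrite qE itv_val_one subrr mul0r mul1r add0r.
- by move=> s /=; rewrite -cd0 -mulrDl subrK mul1r -pE path_zero.
- by move=> s /=; rewrite -cd1 -mulrDl subrK mul1r -pE path_one.
Qed.

Lemma eq_path_homotopic x y (p q : {path I from x to y}) :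
  p =1 q -> path_homotopic p q.
Proof.
move=> pq; apply: (@reparam_homotopic _ _ _ _ p itv_val itv_val) => //.
- exact: itv_val_continuous.
- exact: itv_val_continuous.
- by move=> t; rewrite itv_clamp_val.
- by move=> t; rewrite itv_clamp_val pq.
Qed.

Lemma path_homotopic_refl x y (p : {path I from x to y}) : path_homotopic p p.
Proof. exact: eq_path_homotopic. Qed.

Lemma path_homotopic_sym x y (p q : {path I from x to y}) :
  path_homotopic p q -> path_homotopic q p.
Proof.
case=> h [ch h0 h1 hx hy].
exists (fun u => h (itv_clamp (itv_val u.1), itv_clamp (1 - itv_val u.2))).
split.
- apply: comp_itv_clamp2_continuous => //; first exact: itv_val_fst_continuous.
  by itv_continuity.
- move=> t /=; rewrite itv_val_zero subr0 (@itv_clamp_ge1 1) // itv_clamp_val.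
  exact: h1.
- move=> t /=; rewrite itv_val_one subrr (@itv_clamp_le0 0) // itv_clamp_val.
  exact: h0.
- by move=> s /=; rewrite itv_clamp_val.
- by move=> s /=; rewrite itv_clamp_val.
Qed.

Lemma path_homotopic_trans x y (p q r : {path I from x to y}) :
  path_homotopic p q -> path_homotopic q r -> path_homotopic p r.
Proof.
case=> h [ch h0 h1 hx hy] [k [ck k0 k1 kx ky]].
exists (fun u => if itv_val u.2 <= 2^-1
  then h (itv_clamp (itv_val u.1), itv_clamp (2 * itv_val u.2))
  else k (itv_clamp (itv_val u.1), itv_clamp (2 * itv_val u.2 - 1))).
have c2 : continuous (fun u : I * I => 2 * itv_val u.2 : R).
  by itv_continuity.
split.
- apply: continuous_if_le.
  + apply: comp_itv_clamp2_continuous => //; exact: itv_val_fst_continuous.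
  + apply: comp_itv_clamp2_continuous => //; first exact: itv_val_fst_continuous.
    by itv_continuity.
  + exact: itv_val_snd_continuous.
  + move=> [t s] /= ->; rewrite itv_clamp_val mulfV ?pnatr_eq0 // subrr.
    by rewrite itv_clamp_ge1 // itv_clamp_le0 // h1 k0.
- move=> t /=; rewrite itv_val_zero invr_ge0 ler0n mulr0 itv_clamp_val.
  by rewrite itv_clamp_le0.
- move=> t /=; rewrite itv_val_one ifF; last by apply/negbTE; lra.
  by rewrite itv_clamp_val itv_clamp_ge1 //; lra.
- by move=> s /=; rewrite itv_clamp_val; case: ifP.
- by move=> s /=; rewrite itv_clamp_val; case: ifP.
Qed.

Lemma path_cat_homotopic x y z (p p' : {path I from x to y})
    (q q' : {path I from y to z}) :
  path_homotopic p p' -> path_homotopic q q' ->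
  path_homotopic (path_cat p q) (path_cat p' q').
Proof.
case=> h [ch h0 h1 hx hy] [k [ck k0 k1 kx ky]].
exists (fun u => if itv_val u.1 <= 2^-1
  then h (itv_clamp (2 * itv_val u.1), itv_clamp (itv_val u.2))
  else k (itv_clamp (2 * itv_val u.1 - 1), itv_clamp (itv_val u.2))).
have c2 : continuous (fun u : I * I => 2 * itv_val u.1 : R).
  by itv_continuity.
split.
- apply: continuous_if_le.
  + apply: comp_itv_clamp2_continuous => //; exact: itv_val_snd_continuous.
  + apply: comp_itv_clamp2_continuous => //; last exact: itv_val_snd_continuous.
    by itv_continuity.
  + exact: itv_val_fst_continuous.
  + move=> [t s] /= ->; rewrite itv_clamp_val mulfV ?pnatr_eq0 // subrr.
    by rewrite itv_clamp_ge1 // itv_clamp_le0 // hy kx.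
- by move=> t /=; rewrite /mk_path /path_cat_fun itv_clamp_val h0 k0.
- by move=> t /=; rewrite /mk_path /path_cat_fun itv_clamp_val h1 k1.
- move=> s /=; rewrite itv_val_zero invr_ge0 ler0n mulr0 itv_clamp_le0 //.
- move=> s /=; rewrite itv_val_one ifF; last by apply/negbTE; lra.
  by rewrite [X in k (X, _)]itv_clamp_ge1 //; lra.
Qed.

Lemma path_inv_homotopic x y (p p' : {path I from x to y}) :
  path_homotopic p p' -> path_homotopic (path_inv p) (path_inv p').
Proof.
case=> h [ch h0 h1 hx hy].
exists (fun u => h (itv_clamp (1 - itv_val u.1), itv_clamp (itv_val u.2))).
split.
- apply: comp_itv_clamp2_continuous => //; last exact: itv_val_snd_continuous.
  by itv_continuity.
- by move=> t /=; rewrite itv_clamp_val h0.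
- by move=> t /=; rewrite itv_clamp_val h1.
- by move=> s /=; rewrite itv_val_zero subr0 (@itv_clamp_ge1 1) // hy.
- by move=> s /=; rewrite itv_val_one subrr (@itv_clamp_le0 0) // hx.
Qed.

Lemma path_catA x y z w (p : {path I from x to y}) (q : {path I from y to z})
    (r : {path I from z to w}) :
  path_homotopic (path_cat p (path_cat q r)) (path_cat (path_cat p q) r).
Proof.
apply: (@reparam_homotopic _ _ _ _ (path_cat (path_cat p q) r)
  (fun t => Num.max (2^-1 * itv_val t)
    (Num.max (itv_val t - 4^-1) (2 * itv_val t - 1))) itv_val).
- by itv_continuity.
- exact: itv_val_continuous.
- rewrite itv_val_zero mulr0 !sub0r max_l // ge_max; apply/andP; split; lra.
- rewrite itv_val_one; rewrite (@max_r _ _ (1 - 4^-1)); last by lra.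
  by rewrite max_r; lra.
- move=> t; have t0 := itv_val_ge0 t; have t1 := itv_val_le1 t.
  rewrite /= /mk_path /path_cat_fun.
  have [tle|tgt] := leP (itv_val t) 2^-1.
    rewrite max_l; last by rewrite ge_max; apply/andP; split; lra.
    rewrite itv_clampK; [|lra|lra]; rewrite ifT; last by lra.
    rewrite itv_clampK; [|lra|lra]; rewrite ifT; last by lra.
    by congr (p (itv_clamp _)); field.
  rewrite itv_clampK; [|lra|lra].
  have [tle4|tgt4] := leP (2 * itv_val t - 1) 2^-1.
    rewrite (@max_l _ _ (itv_val t - 4^-1)); last by lra.
    rewrite max_r; last by lra.
    rewrite itv_clampK; [|lra|lra]; rewrite ifT; last by lra.
    rewrite itv_clampK; [|lra|lra]; rewrite ifF; last by apply/negbTE; lra.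
    by congr (q (itv_clamp _)); field.
  rewrite (@max_r _ _ (itv_val t - 4^-1)); last by lra.
  rewrite max_r; last by lra.
  by rewrite itv_clampK; [|lra|lra]; rewrite ifF //; apply/negbTE; lra.
- by move=> t; rewrite itv_clamp_val.
Qed.

Lemma path_cat1p x y (p : {path I from x to y}) :
  path_homotopic (path_cat (cst_path x) p) p.
Proof.
apply: (@reparam_homotopic _ _ _ _ p
  (fun t => Num.max 0 (2 * itv_val t - 1)) itv_val).
- by itv_continuity.
- exact: itv_val_continuous.
- by rewrite itv_val_zero max_l; lra.
- by rewrite itv_val_one max_r; lra.
- move=> t; rewrite /= /mk_path /path_cat_fun /=.
  have [tle|tgt] := leP (itv_val t) 2^-1.
    by rewrite max_l; [rewrite (@itv_clamp_le0 0) // path_zero|lra].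
  by rewrite max_r //; lra.
- by move=> t; rewrite itv_clamp_val.
Qed.

Lemma path_catp1 x y (p : {path I from x to y}) :
  path_homotopic (path_cat p (cst_path y)) p.
Proof.
apply: (@reparam_homotopic _ _ _ _ p
  (fun t => Num.min 1 (2 * itv_val t)) itv_val).
- by itv_continuity.
- exact: itv_val_continuous.
- by rewrite itv_val_zero min_r; lra.
- by rewrite itv_val_one min_l; lra.
- move=> t; rewrite /= /mk_path /path_cat_fun /=.
  have [tle|tgt] := leP (itv_val t) 2^-1; first by rewrite min_r //; lra.
  by rewrite min_l; [rewrite (@itv_clamp_ge1 1) // path_one|lra].
- by move=> t; rewrite itv_clamp_val.
Qed.

Lemma path_catpV x y (p : {path I from x to y}) :
  path_homotopic (path_cat p (path_inv p)) (cst_path x).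
Proof.
apply: (@reparam_homotopic _ _ _ _ p
  (fun t => Num.min (2 * itv_val t) (2 - 2 * itv_val t)) (fun=> 0)).
- by itv_continuity.
- exact: cont_cst.
- by rewrite /= itv_val_zero min_l; lra.
- by rewrite /= itv_val_one min_r; lra.
- move=> t; have t1 := itv_val_le1 t.
  rewrite /= /mk_path /path_cat_fun /=.
  have [tle|tgt] := leP (itv_val t) 2^-1; first by rewrite min_l //; lra.
  rewrite /path_inv_fun itv_clampK; [|lra|lra].
  by rewrite min_r; [congr (p (itv_clamp _)); ring|lra].
- by move=> t; rewrite (@itv_clamp_le0 0) // path_zero.
Qed.

Lemma path_invK x y (p : {path I from x to y}) :
  path_homotopic (path_inv (path_inv p)) p.
Proof.
apply: eq_path_homotopic => t /=; rewrite /mk_path /path_inv_fun /=.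
have t0 := itv_val_ge0 t; have t1 := itv_val_le1 t.
rewrite /path_inv_fun itv_clampK; [|lra|lra].
by rewrite subKr itv_clamp_val.
Qed.

Lemma path_catVp x y (p : {path I from x to y}) :
  path_homotopic (path_cat (path_inv p) p) (cst_path y).
Proof.
apply: path_homotopic_trans (path_catpV (path_inv p)).
apply: path_cat_homotopic; first exact: path_homotopic_refl.
exact/path_homotopic_sym/path_invK.
Qed.

End Paths.

Section PathClasses.
Context {R : realType} {X : topologicalType}.
Local Notation I := (unit_itv R).
Implicit Types x y z w : X.

Lemma path_inv_cat x y z (p : {path I from x to y}) (q : {path I from y to z}) :
  path_homotopic (path_inv (path_cat p q)) (path_cat (path_inv q) (path_inv p)).
Proof.
apply: eq_path_homotopic => t.
have t0 := itv_val_ge0 t; have t1 := itv_val_le1 t.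
rewrite /= /mk_path /path_inv_fun /path_cat_fun itv_clampK; [|lra|lra].
case: (ltgtP (itv_val t) 2^-1) => [tlt|tgt|teq].
- rewrite ifF; last by apply/negbTE; lra.
  by rewrite /path_inv_fun itv_clampK; [congr (q (itv_clamp _)); ring|lra|lra].
- rewrite ifT; last by lra.
  by rewrite /path_inv_fun itv_clampK; [congr (p (itv_clamp _)); ring|lra|lra].
- rewrite teq ifT; last by lra.
  rewrite /path_inv_fun itv_clamp_ge1; last by lra.
  rewrite itv_clamp_le0; first by rewrite path_one path_zero.
  by rewrite itv_clampK; lra.
Qed.

Section quot.
Context (x y : X).

Definition path_homotopicb (p q : {path I from x to y}) : bool :=
  `[< path_homotopic p q >].

Lemma path_homotopicb_equiv : equiv_class_of path_homotopicb.
Proof.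
split.
- by move=> p; apply/asboolP; exact: path_homotopic_refl.
- by move=> p q; apply/asboolP/asboolP; exact: path_homotopic_sym.
- move=> q p r /asboolP pq /asboolP qr; apply/asboolP.
  exact: path_homotopic_trans pq qr.
Qed.

Canonical path_homotopic_equiv := EquivRelPack path_homotopicb_equiv.

Definition path_quot := {eq_quot path_homotopic_equiv}.
HB.instance Definition _ := Choice.on path_quot.

Definition path_class (p : {path I from x to y}) : path_quot := \pi p.

Lemma path_classP (p q : {path I from x to y}) :
  path_class p = path_class q <-> path_homotopic p q.
Proof.
split; first by move/eqmodP/asboolP.
by move=> pq; apply/eqmodP/asboolP.
Qed.

Definition path_rep (u : path_quot) : {path I from x to y} := repr u.

Lemma path_repK u : path_class (path_rep u) = u.
Proof. exact: reprK. Qed.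

End quot.

Definition class_cat x y z (u : path_quot x y) (v : path_quot y z) :
  path_quot x z := path_class (path_cat (path_rep u) (path_rep v)).

Definition class_inv x y (u : path_quot x y) : path_quot y x :=
  path_class (path_inv (path_rep u)).

Lemma class_catE x y z (p : {path I from x to y}) (q : {path I from y to z}) :
  class_cat (path_class p) (path_class q) = path_class (path_cat p q).
Proof. by apply/path_classP/path_cat_homotopic; apply/path_classP/path_repK. Qed.

Lemma class_invE x y (p : {path I from x to y}) :
  class_inv (path_class p) = path_class (path_inv p).
Proof. by apply/path_classP/path_inv_homotopic/path_classP/path_repK. Qed.

Lemma path_quotP x y (u : path_quot x y) : exists p, u = path_class p.
Proof. by exists (path_rep u); rewrite path_repK. Qed.

Lemma class_catA x y z w (s : path_quot x y) (u : path_quot y z)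
    (v : path_quot z w) :
  class_cat s (class_cat u v) = class_cat (class_cat s u) v.
Proof.
case: (path_quotP s) (path_quotP u) (path_quotP v) => p -> [q ->] [r ->].
rewrite !class_catE; exact/path_classP/path_catA.
Qed.

Lemma class_cat1p x y (u : path_quot x y) :
  class_cat (path_class (cst_path x)) u = u.
Proof.
by case: (path_quotP u) => p ->; rewrite class_catE; exact/path_classP/path_cat1p.
Qed.

Lemma class_catp1 x y (u : path_quot x y) :
  class_cat u (path_class (cst_path y)) = u.
Proof.
by case: (path_quotP u) => p ->; rewrite class_catE; exact/path_classP/path_catp1.
Qed.

Lemma class_catpV x y (u : path_quot x y) :
  class_cat u (class_inv u) = path_class (cst_path x).
Proof.
case: (path_quotP u) => p ->; rewrite class_invE class_catE.
exact/path_classP/path_catpV.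
Qed.

Lemma class_catVp x y (u : path_quot x y) :
  class_cat (class_inv u) u = path_class (cst_path y).
Proof.
case: (path_quotP u) => p ->; rewrite class_invE class_catE.
exact/path_classP/path_catVp.
Qed.

Lemma class_invK x y (u : path_quot x y) : class_inv (class_inv u) = u.
Proof.
by case: (path_quotP u) => p ->; rewrite !class_invE; exact/path_classP/path_invK.
Qed.

Lemma class_inv_cat x y z (u : path_quot x y) (v : path_quot y z) :
  class_inv (class_cat u v) = class_cat (class_inv v) (class_inv u).
Proof.
case: (path_quotP u) (path_quotP v) => p -> [q ->].
rewrite class_catE !class_invE class_catE; exact/path_classP/path_inv_cat.
Qed.

Lemma class_catK x y z (u : path_quot x y) (v : path_quot y z) :
  class_cat (class_cat u v) (class_inv v) = u.
Proof. by rewrite -class_catA class_catpV class_catp1. Qed.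

Lemma class_catVK x y z (u : path_quot x y) (v : path_quot z y) :
  class_cat (class_cat u (class_inv v)) v = u.
Proof. by rewrite -class_catA class_catVp class_catp1. Qed.

End PathClasses.

Definition pi1 (R : realType) (X : topologicalType) (x0 : X) : Type :=
  @path_quot R X x0 x0.

HB.instance Definition _ (R : realType) (X : topologicalType) (x0 : X) :=
  Choice.on (pi1 R x0).
HB.instance Definition _ (R : realType) (X : topologicalType) (x0 : X) :=
  isGroup.Build (pi1 R x0) (@class_catA R X x0 x0 x0 x0)
    (@class_cat1p R X x0 x0) (@class_catp1 R X x0 x0)
    (@class_catVp R X x0 x0) (@class_catpV R X x0 x0).

Lemma pi1_mulE (R : realType) (X : topologicalType) (x0 : X)
  (u v : pi1 R x0) : (u * v)%g = class_cat u v.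
Proof. by []. Qed.

Lemma pi1_invE (R : realType) (X : topologicalType) (x0 : X) (u : pi1 R x0) :
  (u^-1)%g = class_inv u.
Proof. by []. Qed.

Lemma pi1_oneE (R : realType) (X : topologicalType) (x0 : X) :
  1%g = path_class (cst_path x0) :> pi1 R x0.
Proof. by []. Qed.

Definition normal_subgroup (G : groupType) (H : groupClosed G) : Prop :=
  forall g h : G, h \in H -> (h ^ g)%g \in H.

Definition path_connected (R : realType) (X : topologicalType) : Prop :=
  forall x y : X, inhabited {path (unit_itv R) from x to y}.

Section Xtilde.
Context {R : realType} {X : topologicalType} {x0 : X}.
Local Notation I := (unit_itv R).

Definition path_from : Type := {y : X & {path I from x0 to y}}.
HB.instance Definition _ := Choice.on path_from.

Definition to_path_from {y} (a : {path I from x0 to y}) : path_from :=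
  Tagged (fun y => {path I from x0 to y}) a.

Definition path_end (a : path_from) : X := tag a.

Context (H : groupClosed (pi1 R x0)).

(* b' is b itself, typed as a path ending where a ends: its existence states
   that the end points agree. *)
Definition path_sim (a b : path_from) : Prop :=
  exists2 b' : {path I from x0 to path_end a}, b = to_path_from b' &
    (path_class (path_cat (tagged a) (path_inv b')) : pi1 R x0) \in H.

Definition path_simb (a b : path_from) : bool := `[< path_sim a b >].

Lemma path_simb_equiv : equiv_class_of path_simb.
Proof.
have sym a b : path_sim a b -> path_sim b a.
  case: a => y a [b' /= -> abH]; exists a => //=.
  rewrite -class_catE -class_invE -[path_class b']class_invK -class_inv_cat.
  rewrite class_invE class_catE.
  exact: (gpredVr (s := H)).
split.
- move=> [y a]; apply/asboolP; exists a => //=.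
  by rewrite -class_catE -class_invE class_catpV; exact: (gpred1 (s := H)).
- by move=> a b; apply/asboolP/asboolP; exact: sym.
- move=> b [y a] c /asboolP[/= b' -> abH] /asboolP[/= c' -> bcH].
  apply/asboolP; exists c' => //=.
  have := gpredM _ _ abH bcH.
  by rewrite pi1_mulE -!class_catE class_catA -!class_invE class_catVK.
Qed.

Canonical path_sim_equiv := EquivRelPack path_simb_equiv.

Definition Xtilde : Type := {eq_quot path_sim_equiv}.
HB.instance Definition _ := Choice.on Xtilde.

Definition classH {y} (a : {path I from x0 to y}) : Xtilde :=
  \pi_{eq_quot path_sim_equiv} (to_path_from a).

Definition p_H (c : Xtilde) : X := path_end (repr (c : {eq_quot path_sim_equiv})).

Lemma classHP (c : Xtilde) :
  exists y, exists a : {path I from x0 to y}, c = classH a.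
Proof.
exists (path_end (repr (c : {eq_quot path_sim_equiv}))).
exists (tagged (repr (c : {eq_quot path_sim_equiv}))).
by rewrite /classH /to_path_from taggedK reprK.
Qed.

Lemma classH_path_sim y z (a : {path I from x0 to y})
    (b : {path I from x0 to z}) :
  classH a = classH b <->
  path_sim (to_path_from a) (to_path_from b).
Proof.
split; first by move/eqmodP/asboolP.
by move=> ab; apply/eqmodP/asboolP.
Qed.

Lemma path_sim_end (a b : path_from) : path_sim a b -> path_end a = path_end b.
Proof. by case=> b' ->. Qed.

Lemma classH_end y z (a : {path I from x0 to y}) (b : {path I from x0 to z}) :
  classH a = classH b -> y = z.
Proof. by move/classH_path_sim/path_sim_end. Qed.

Lemma classHE y (a b : {path I from x0 to y}) :
  classH a = classH b <->
  (path_class (path_cat a (path_inv b)) : pi1 R x0) \in H.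
Proof.
rewrite classH_path_sim; split; last by exists b.
by case=> b' /= E abH; rewrite (existT_inj2 E).
Qed.

Lemma classH_homotopic y (a b : {path I from x0 to y}) :
  path_homotopic a b -> classH a = classH b.
Proof.
move=> /path_classP ab; apply/classHE.
by rewrite -class_catE ab -class_invE class_catpV; exact: (gpred1 (s := H)).
Qed.

Lemma classH_cat y z (a b : {path I from x0 to y}) (d : {path I from y to z}) :
  classH a = classH b -> classH (path_cat a d) = classH (path_cat b d).
Proof.
move=> /classHE abH; apply/classHE.
rewrite -!class_catE -class_invE -class_catE class_inv_cat class_catA class_catK.
by rewrite class_invE class_catE.
Qed.

Lemma classH_catA y z w (a : {path I from x0 to y}) (b : {path I from y to z})
    (d : {path I from z to w}) :
  classH (path_cat (path_cat a b) d) = classH (path_cat a (path_cat b d)).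
Proof. exact/classH_homotopic/path_homotopic_sym/path_catA. Qed.

Lemma classH_catp1 y (a : {path I from x0 to y}) :
  classH (path_cat a (cst_path y)) = classH a.
Proof. exact/classH_homotopic/path_catp1. Qed.

Lemma p_H_classH y (a : {path I from x0 to y}) : p_H (classH a) = y.
Proof.
apply/esym; rewrite /p_H.
set r := repr _; have : classH a = classH (tagged r).
  by rewrite {2}/classH /to_path_from taggedK /r reprK.
by move/classH_end.
Qed.

Definition whisker_nbhd (a : path_from) (U : set X) : set Xtilde :=
  [set c | exists z (b : {path I from path_end a to z}),
    range b `<=` U /\ c = classH (path_cat (tagged a) b)].

(* Copy of Xtilde carrying the whisker topology. *)
Definition Xtilde_wh : Type := Xtilde.
HB.instance Definition _ := Choice.on Xtilde_wh.

Definition path_from_pointed : path_from := to_path_from (cst_path x0).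
HB.instance Definition _ := isPointed.Build path_from path_from_pointed.

Definition whisker_index : set (path_from * set X) :=
  [set i | open i.2 /\ i.2 (path_end i.1)].

Lemma whisker_cover :
  \bigcup_(i in whisker_index) whisker_nbhd i.1 i.2 = [set: Xtilde_wh].
Proof.
apply/seteqP; split => // c _; have [y [a ->]] := classHP c.
exists (to_path_from a, setT) => /=.
  by split => //; exact: openT.
by exists y, (cst_path y); rewrite classH_catp1.
Qed.

Lemma path_cat_range x y z (p : {path I from x to y}) (q : {path I from y to z})
    (U : set X) :
  range p `<=` U -> range q `<=` U -> range (path_cat p q) `<=` U.
Proof.
move=> pU qU _ [t _ <-] /=; rewrite /mk_path /path_cat_fun.
by case: ifP => _; [apply: pU|apply: qU]; eexists.
Qed.

Lemma whisker_join (i j : path_from * set X) (c : Xtilde_wh) :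
  whisker_index i -> whisker_index j ->
  whisker_nbhd i.1 i.2 c -> whisker_nbhd j.1 j.2 c ->
  exists k, [/\ whisker_index k, whisker_nbhd k.1 k.2 c &
    whisker_nbhd k.1 k.2 `<=`
      whisker_nbhd i.1 i.2 `&` whisker_nbhd j.1 j.2].
Proof.
case: i j => [[y a] U] [[y' a'] V] /= [/= oU Uy] [/= oV Vy'].
move=> [z [b /= [bU ->]]] [z' [b' /= [bV E]]].
have zz' := classH_end E; subst z'.
exists (to_path_from (path_cat a b), U `&` V).
split => /=.
- split; first exact: openI.
  split; first by apply: bU; exists one => //; rewrite path_one.
  by apply: bV; exists one => //; rewrite path_one.
- exists z, (cst_path z); rewrite classH_catp1; split => // _ [t _ <-] /=.
  split; first by apply: bU; exists one => //; rewrite path_one.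
  by apply: bV; exists one => //; rewrite path_one.
- move=> _ [w [d /= [dUV ->]]]; split.
    exists w, (path_cat b d); rewrite classH_catA; split => //.
    by apply: path_cat_range => // u /dUV[].
  exists w, (path_cat b' d); rewrite (classH_cat d E) classH_catA; split => //.
  by apply: path_cat_range => // u /dUV[].
Qed.

HB.instance Definition _ :=
  isBaseTopological.Build Xtilde_wh whisker_cover whisker_join.

Definition fiber : set Xtilde_wh := [set c | p_H c = x0].

Definition is_H_SLT : Prop :=
  forall (y : X) (a : {path I from x0 to y}) (U : set X), open U -> U x0 ->
  exists V : set X, [/\ open V, V y &
    forall b : {path I from y to y}, range b `<=` V ->
    exists2 g : {path I from x0 to x0}, range g `<=` U &
      classH (path_cat (path_cat a b) (path_inv a)) = classH g].

Lemma classH_fiber (l : {path I from x0 to x0}) :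
  (classH l : Xtilde_wh) \in fiber.
Proof. by apply/mem_set; exact: p_H_classH. Qed.

Definition fiber_class (l : {path I from x0 to x0}) : fiber :=
  exist (fun c => c \in fiber) (classH l) (classH_fiber l).

Lemma fiber_classP (u : fiber) : exists l, u = fiber_class l.
Proof.
case: u => c cx; have [y [a cE]] := classHP c; subst c.
have := set_mem cx; rewrite /fiber /= p_H_classH => yx0; subst y.
by exists a; exact: val_inj.
Qed.

Lemma fiber_classE (l m : {path I from x0 to x0}) :
  fiber_class l = fiber_class m <-> classH l = classH m.
Proof. by split; [move/(congr1 val)|move=> lm; exact: val_inj]. Qed.

Definition fiber_rep (u : fiber) : {path I from x0 to x0} :=
  projT1 (cid (fiber_classP u)).

Lemma fiber_repK u : fiber_class (fiber_rep u) = u.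
Proof. exact/esym/(projT2 (cid (fiber_classP u))). Qed.

Definition fiber_mul (u v : fiber) : fiber :=
  fiber_class (path_cat (fiber_rep u) (fiber_rep v)).

Definition fiber_inv (u : fiber) : fiber := fiber_class (path_inv (fiber_rep u)).

Section Normal.
Context (nH : normal_subgroup H).

Let loop_class (l : {path I from x0 to x0}) : pi1 R x0 := path_class l.

Let loop_classM l m :
  loop_class (path_cat l m) = (loop_class l * loop_class m)%g.
Proof. by rewrite pi1_mulE class_catE. Qed.

Let loop_classV l : loop_class (path_inv l) = (loop_class l)^-1%g.
Proof. by rewrite pi1_invE class_invE. Qed.

Let classH_loop l m :
  classH l = classH m <-> (loop_class l / loop_class m)%g \in H.
Proof. by rewrite classHE -loop_classV -loop_classM. Qed.

(* fiber_mul concatenates chosen representatives; by normality the choice is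
   irrelevant. *)
Lemma fiber_classM (l m : {path I from x0 to x0}) :
  fiber_mul (fiber_class l) (fiber_class m) = fiber_class (path_cat l m).
Proof.
apply/fiber_classE; rewrite (classH_cat _ (proj1 (fiber_classE _ _) (fiber_repK _))).
set m' := fiber_rep _.
have /classH_loop/(nH (loop_class l)^-1%g) : classH m' = classH m.
  by apply/fiber_classE/fiber_repK.
move=> H1; apply/classH_loop; move: H1.
by rewrite !loop_classM /conjg invgK invgM !mulgA.
Qed.

Lemma fiber_classV (l : {path I from x0 to x0}) :
  fiber_inv (fiber_class l) = fiber_class (path_inv l).
Proof.
apply/fiber_classE; set l' := fiber_rep _.
have /esym/classH_loop/(nH (loop_class l)) : classH l' = classH l.
  by apply/fiber_classE/fiber_repK.
move=> H1; apply/classH_loop; move: H1.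
by rewrite !loop_classV /conjg invgK !mulgA mulVg mul1g.
Qed.

Lemma fiber_mulA : associative fiber_mul.
Proof.
move=> u v w; have [l ->] := fiber_classP u; have [m ->] := fiber_classP v.
have [n ->] := fiber_classP w.
rewrite !fiber_classM; apply/fiber_classE.
exact/esym/classH_catA.
Qed.

Lemma fiber_mul1 : left_id (fiber_class (cst_path x0)) fiber_mul.
Proof.
move=> u; have [l ->] := fiber_classP u.
by rewrite fiber_classM; apply/fiber_classE/classH_homotopic/path_cat1p.
Qed.

Lemma fiber_mulr1 : right_id (fiber_class (cst_path x0)) fiber_mul.
Proof.
move=> u; have [l ->] := fiber_classP u.
by rewrite fiber_classM; apply/fiber_classE/classH_homotopic/path_catp1.
Qed.

Lemma fiber_mulV : left_inverse (fiber_class (cst_path x0)) fiber_inv fiber_mul.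
Proof.
move=> u; have [l ->] := fiber_classP u.
rewrite fiber_classV fiber_classM; apply/fiber_classE/classH_homotopic.
exact: path_catVp.
Qed.

Lemma fiber_mulVr :
  right_inverse (fiber_class (cst_path x0)) fiber_inv fiber_mul.
Proof.
move=> u; have [l ->] := fiber_classP u.
rewrite fiber_classV fiber_classM; apply/fiber_classE/classH_homotopic.
exact: path_catpV.
Qed.

End Normal.
End Xtilde.

Arguments path_from R {X} x0.
Arguments classH {R X x0} H {y} a.
Arguments whisker_nbhd {R X x0} H a U.
Arguments fiber {R X x0} H.
Arguments fiber_class {R X x0} H l.
Arguments is_H_SLT {R X x0} H.

#[short(type="preTopologicalGroupType")]
HB.structure Definition PreTopologicalGroup := {G of Topological G & Group G}.

Definition is_topological_group (G : preTopologicalGroupType) : Prop :=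
  continuous (fun u : G * G => (u.1 * u.2)%g) /\
  continuous (fun u : G => u^-1%g).

(* The fiber with its whisker topology and group structure; the proof that H is
   normal is an argument because the group laws depend on it. *)
Definition fiber_group (R : realType) (X : topologicalType) (x0 : X)
  (H : groupClosed (pi1 R x0)) (nH : normal_subgroup H) : Type := fiber H.

Section FiberGroup.
Context {R : realType} {X : topologicalType} {x0 : X}.
Context (H : groupClosed (pi1 R x0)) (nH : normal_subgroup H).

HB.instance Definition _ := Topological.copy (fiber_group nH) (fiber H).
HB.instance Definition _ := isGroup.Build (fiber_group nH)
  (fiber_mulA nH) (fiber_mul1 nH) (fiber_mulr1 nH) (fiber_mulV nH)
  (fiber_mulVr nH).

End FiberGroup.

(* Main.v *)
Require Import Defs.
From HB Require Import structures.
From mathcomp Require Import all_boot all_order all_algebra.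
From mathcomp Require Import all_classical all_reals.
From mathcomp Require Import topology normedtype homotopy.

Set Implicit Arguments.
Unset Strict Implicit.
Unset Printing Implicit Defensive.

(** The neighborhoods of a class [l] in the fiber are generated by the sets
  [l] * N(U), where U is an open set containing x0 and N(U) is the set of the
  classes of the loops in U based at x0 ([nbhs_fiberP]); N(U) is closed under
  products and inverses, because concatenating or reversing loops does not
  leave U.  So left translations are well behaved in every case, and only
  conjugation can obstruct continuity:

    (l b)(m c) = l m ((m^-1 b m) c)   and   (l b)^-1 = l^-1 (l b^-1 l^-1).

  The H-SLT condition, applied to paths that are loops at x0, says exactly that
  conjugation by a fixed class is continuous at the identity: it maps some N(V)
  into N(U) ([fiber_conj_small]).  Taking b in N(V) and c in N(U), the two
  displayed products lie in l m N(U) and in l^-1 N(U). *)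

Local Open Scope classical_set_scope.

Section SmallLoops.
Context {R : realType} {X : topologicalType} {x0 : X}.
Context (H : groupClosed (pi1 R x0)).
Local Notation I := (unit_itv R).

Lemma path_inv_range (x y : X) (p : {path I from x to y}) (U : set X) :
  range p `<=` U -> range (path_inv p) `<=` U.
Proof. by move=> pU _ [t _ <-]; apply: pU; eexists. Qed.

(** Every basic whisker set containing [l] contains one centred at [l]: if
  [l] = [a * b] with b in U, then [l * d] = [a * (b * d)] for each d in U. *)
Lemma nbhs_fiberP (l : {path I from x0 to x0}) (A : set (fiber H)) :
  nbhs (fiber_class H l) A <->
  exists U : set X, [/\ open U, U x0 &
    forall b : {path I from x0 to x0}, range b `<=` U ->
      A (fiber_class H (path_cat l b))].
Proof.
split.
  rewrite nbhsE => -[_ [[B [D sD <-] <-]] [i Di il] BA].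
  have [] := sD _ Di; case: i Di il => [[y a] U] Di /= [z [b [bU ab]]] oU Uy.
  rewrite set_valE /= in ab; have zE := classH_end ab; subst z.
  have Ux0 : U x0 by apply: bU; exists one; rewrite // path_one.
  exists U; split=> // d dU; apply: BA; exists (to_path_from a, U) => //=.
  exists x0, (path_cat b d); split; first exact: path_cat_range.
  by rewrite set_valE /= (classH_cat d ab) classH_catA.
case=> U [oU Ux0 UA]; rewrite nbhsE.
exists (set_val @^-1` (whisker_nbhd H (to_path_from l) U : set (Xtilde_wh H))).
  split; last first.
    exists x0, (cst_path x0); rewrite classH_catp1; split=> //.
    by move=> _ [t _ <-].
  exists (whisker_nbhd H (to_path_from l) U) => //.
  exists [set (to_path_from l, U)]; last by rewrite bigcup_set1.
  by move=> _ ->.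
move=> u [z [b [bU uE]]].
have zE : z = x0.
  by have := set_mem (valP u); rewrite /fiber /= -set_valE uE p_H_classH.
subst z.
have -> : u = fiber_class H (path_cat l b) by apply: val_inj.
exact: UA.
Qed.

End SmallLoops.

Section FiberGroup.
Context {R : realType} {X : topologicalType} {x0 : X}.
Context (H : groupClosed (pi1 R x0)) (nH : normal_subgroup H).
Local Notation I := (unit_itv R).
Local Notation cl l := (fiber_class H l : fiber_group nH).
Local Open Scope group_scope.

Lemma fiber_group_cat (l m : {path I from x0 to x0}) :
  cl (path_cat l m) = cl l * cl m.
Proof. exact/esym/(fiber_classM nH). Qed.

Lemma fiber_group_inv (l : {path I from x0 to x0}) :
  cl (path_inv l) = (cl l)^-1.
Proof. exact/esym/(fiber_classV nH). Qed.

(** The H-SLT condition at the path l^-1 is continuity at 1 of conjugation by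
  the class of l. *)
Lemma fiber_conj_small (l : {path I from x0 to x0}) (U : set X) :
  is_H_SLT H -> open U -> U x0 ->
  exists V : set X, [/\ open V, V x0 &
    forall b : {path I from x0 to x0}, range b `<=` V ->
    exists2 g : {path I from x0 to x0}, range g `<=` U &
      cl b ^ cl l = cl g].
Proof.
move=> slt oU Ux0; have [V [oV Vx0 VU]] := slt x0 (path_inv l) U oU Ux0.
exists V; split=> // b /VU[g gU /fiber_classE gE]; exists g => //.
rewrite -gE !fiber_group_cat (fiber_group_inv (path_inv l)) fiber_group_inv.
by rewrite invgK /conjg mulgA.
Qed.

Lemma fiber_mul_continuous : is_H_SLT H ->
  continuous (fun u : fiber_group nH * fiber_group nH => u.1 * u.2).
Proof.
move=> slt [u v]; have [l ->] := fiber_classP u; have [m ->] := fiber_classP v.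
move=> A /=; rewrite -[_ * _]fiber_group_cat => /nbhs_fiberP[U [oU Ux0 UA]].
have [V [oV Vx0 VU]] := fiber_conj_small m slt oU Ux0.
pose N W l := [set w | exists2 b : {path I from x0 to x0}, range b `<=` W &
  w = cl (path_cat l b)].
exists (N V l, N U m).
  by split; apply/nbhs_fiberP; [exists V|exists U]; split=> // b bW; exists b.
move=> [_ _] [/= [b /VU[g gU bE] ->] [c cU ->]] /=.
suff -> : cl (path_cat l b) * cl (path_cat m c) =
    cl (path_cat (path_cat l m) (path_cat g c)).
  by apply: UA; exact: path_cat_range.
by rewrite !fiber_group_cat -bE /conjg !mulgA mulgK.
Qed.

Lemma fiber_inv_continuous : is_H_SLT H ->
  continuous (fun u : fiber_group nH => u^-1).
Proof.
move=> slt u; have [l ->] := fiber_classP u.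
move=> A /=; rewrite -[_^-1]fiber_group_inv => /nbhs_fiberP[U [oU Ux0 UA]].
have [V [oV Vx0 VU]] := fiber_conj_small (path_inv l) slt oU Ux0.
apply/nbhs_fiberP; exists V; split=> // b /path_inv_range/VU[g gU bE] /=.
suff -> : (cl (path_cat l b))^-1 = cl (path_cat (path_inv l) g).
  exact: UA.
rewrite !fiber_group_cat -bE !fiber_group_inv.
by rewrite /conjg invgK !mulgA mulVg mul1g invgM.
Qed.

End FiberGroup.

Theorem corollary2p3 (R : realType) (X : topologicalType) (x0 : X)
    (H : groupClosed (pi1 R x0)) (nH : normal_subgroup H) :
  path_connected R X -> is_H_SLT H -> is_topological_group (fiber_group nH).
Proof.
move=> _ slt; split.
  exact: fiber_mul_continuous.
exact: fiber_inv_continuous.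
Qed.
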